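(* Let $1 \le p < \infty$ and let $X$ be a (real) Banach lattice with norm $\|\cdot\|$ which satisfies a lower $p$-estimate. For $x \in X$ put $$\|x\|_0 = \sup\Big(\sum_i \|x_i\|^p\Big)^{1/p},$$ where the supremum is taken over all finite families $(x_i)$ of pairwise disjoint elements of $X$ such that $x = \sum_i x_i$. Then the norm $\|\cdot\|_0$ is $\tau$-UKK, i.e. for every $\varepsilon > 0$ there exists $\delta > 0$ such that for every sequence $(x_n)$ in $X$ with $\|x_n\|_0 \le 1$ for all $n$, $\inf\{\|x_n - x_m\|_0 : n \ne m\} \ge \varepsilon$, and $(x_n)$ $\tau$-convergent to some $x \in X$, one has $\|x\|_0 \le 1 - \delta$.
   Context: Two elements $x,y$ of a Banach lattice are disjoint if $|x| \wedge |y| = 0$. A Banach lattice $X$ satisfies a lower $p$-estimate ($1 \le p < \infty$) if there is a constant $C < \infty$ such that for every finite family $(x_i)_{1\le i\le n}$ of pairwise disjoint elements of $X$, $\big(\sum_i \|x_i\|^p\big)^{1/p} \le C\,\|\sum_i x_i\|$. The topology $\tau$ on a Banach lattice $X$ is the coarsest linear topology for which the maps $x \mapsto \|\,|x| \wedge |u|\,\|$ are continuous at $0$ for every $u \in X$. A basis of neighborhoods of a point $x \in X$ is formed by the sets $\{y \in X : \|\,|y-x| \wedge u\| \le \varepsilon\}$ with $u \in X$, $u \ge 0$, and $\varepsilon > 0$; so $x_n \to x$ in $\tau$ iff $\|\,|x_n - x| \wedge u\| \to 0$ for every $u \ge 0$ in $X$. When $X$ satisfies a lower $p$-estimate with constant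 $C$, $\|\cdot\|_0$ is a norm on $X$ with $\|\cdot\| \le \|\cdot\|_0 \le C\|\cdot\|$. The topology $\tau$ is unchanged when $\|\cdot\|$ is replaced by an equivalent norm. *)

(* Defs.v *)
From HB Require Import structures.
From mathcomp Require Import all_boot all_order all_algebra.
From mathcomp Require Import boolp classical_sets functions reals.
From mathcomp Require Import topology normedtype sequences exp.
From mathcomp Require Import lra.

Set Implicit Arguments.
Unset Strict Implicit.
Unset Printing Implicit Defensive.

Import Order.TTheory GRing.Theory Num.Theory.
Import numFieldNormedType.Exports.

Local Open Scope classical_set_scope.
Local Open Scope ring_scope.

(* The order is a field of the mixin because no Hierarchy-Builder structure
   may join Order.Lattice and GRing.Zmodule without also joining the numeric
   hierarchy.  The library's lattice theory is available through the alias
   [blat V] below.  In [bnorm_mono], the lattice modulus |x| = x \/ - x is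
   written out. *)
HB.mixin Record isBanachLattice (R : realType) V
    of CompleteNormedModule R V := {
  ble : rel V ;
  bmeet : V -> V -> V ;
  bjoin : V -> V -> V ;
  ble_refl : reflexive ble ;
  ble_anti : antisymmetric ble ;
  ble_trans : transitive ble ;
  ble_meet : forall x y z : V, ble x (bmeet y z) = ble x y && ble x z ;
  ble_join : forall x y z : V, ble (bjoin x y) z = ble x z && ble y z ;
  bleD2r : forall z x y : V, ble x y -> ble (x + z) (y + z) ;
  bleZ : forall (a : R) (x y : V), 0 <= a -> ble x y -> ble (a *: x) (a *: y) ;
  bnorm_mono : forall x y : V,
    ble (bjoin x (- x)) (bjoin y (- y)) -> `|x| <= `|y|
}.

#[short(type="banachLatticeType")]
HB.structure Definition BanachLattice (R : realType) :=
  {V of isBanachLattice R V & CompleteNormedModule R V}.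

Definition blat (R : realType) (V : banachLatticeType R) : Type := V.

Fact blat_display : Order.disp_t. Proof. exact: Order.Disp tt tt. Qed.

HB.instance Definition _ (R : realType) (V : banachLatticeType R) :=
  Choice.on (blat V).
HB.instance Definition _ (R : realType) (V : banachLatticeType R) :=
  Order.Le_isPOrder.Build blat_display (blat V)
    (@ble_refl R V) (@ble_anti R V) (@ble_trans R V).
HB.instance Definition _ (R : realType) (V : banachLatticeType R) :=
  Order.POrder_isMeetSemilattice.Build blat_display (blat V) (@ble_meet R V).
HB.instance Definition _ (R : realType) (V : banachLatticeType R) :=
  Order.POrder_isJoinSemilattice.Build blat_display (blat V) (@ble_join R V).

Section BanachLatticeTheory.
Context (R : realType) (V : banachLatticeType R).
Implicit Types (x y z u : V) (a e : R).

Definition babs x : V := bjoin x (- x).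

Definition bdisjoint x y := bmeet (babs x) (babs y) = 0.

Lemma ble_meetl x y : ble (bmeet x y) x.
Proof. by have := ble_refl (bmeet x y); rewrite ble_meet => /andP[]. Qed.

Lemma ble_meetr x y : ble (bmeet x y) y.
Proof. by have := ble_refl (bmeet x y); rewrite ble_meet => /andP[]. Qed.

Lemma ble_joinl x y : ble x (bjoin x y).
Proof. by have := ble_refl (bjoin x y); rewrite ble_join => /andP[]. Qed.

Lemma ble_joinr x y : ble y (bjoin x y).
Proof. by have := ble_refl (bjoin x y); rewrite ble_join => /andP[]. Qed.

Lemma ble_tr y x z : ble x y -> ble y z -> ble x z.
Proof. exact: ble_trans. Qed.

Lemma bleD x y z u : ble x y -> ble z u -> ble (x + z) (y + u).
Proof.
move=> xy zu; apply: (@ble_tr (y + z)); first exact: bleD2r.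
by rewrite ![y + _]addrC; exact: bleD2r.
Qed.

Lemma bleBl x y z : ble (x - y) z = ble x (z + y).
Proof.
apply/idP/idP => /bleD2r; first by move/(_ y); rewrite subrK.
by move/(_ (- y)); rewrite addrK.
Qed.

Lemma bmeet_mono x y z u : ble x y -> ble z u -> ble (bmeet x z) (bmeet y u).
Proof.
move=> xy zu; rewrite ble_meet (ble_tr (ble_meetl _ _) xy).
by rewrite (ble_tr (ble_meetr _ _) zu).
Qed.

Lemma babs_ge0 x : ble 0 (babs x).
Proof.
have h : ble 0 (babs x + babs x).
  by rewrite -(subrr x); apply: bleD; [exact: ble_joinl|exact: ble_joinr].
have h2 : 0 <= 2^-1 :> R by rewrite invr_ge0.
have := bleZ _ _ _ h2 h.
rewrite scaler0 scalerDr -scalerDl.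
by have -> : 2^-1 + 2^-1 = 1 :> R; [lra|rewrite scale1r].
Qed.

Lemma babs_id x : ble 0 x -> babs x = x.
Proof.
move=> x0; apply: ble_anti; rewrite ble_joinl andbT ble_join ble_refl /=.
by rewrite -[- x]add0r bleBl (ble_tr x0)// -[X in ble X _]addr0 bleD ?ble_refl.
Qed.

Lemma babsN x : babs (- x) = babs x.
Proof.
by apply: ble_anti; rewrite /babs !opprK !ble_join !ble_joinl !ble_joinr.
Qed.

Lemma babs0 : babs 0 = 0.
Proof. by rewrite babs_id ?ble_refl. Qed.

Lemma babsD x y : ble (babs (x + y)) (babs x + babs y).
Proof. by rewrite ble_join opprD !bleD// (ble_joinl, ble_joinr). Qed.

Lemma babsZ a x : ble (babs (a *: x)) (`|a| *: babs x).
Proof.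
wlog a0 : a x / 0 <= a.
  move=> h; have [/h//|a0] := leP 0 a.
  have := h (- a) (- x); rewrite scalerN scaleNr opprK normrN babsN.
  by apply; rewrite oppr_ge0 ltW.
by rewrite ger0_norm// ble_join -scalerN !bleZ// (ble_joinl, ble_joinr).
Qed.

Lemma ble_norm x y : ble 0 x -> ble x y -> `|x| <= `|y|.
Proof.
move=> x0 xy; apply: bnorm_mono; rewrite -/(babs x) -/(babs y) !babs_id//.
exact: ble_tr xy.
Qed.

Lemma bmeet_ge0 x y : ble 0 x -> ble 0 y -> ble 0 (bmeet x y).
Proof. by rewrite ble_meet => -> ->. Qed.

Lemma bmeetDl x y u : ble 0 x -> ble 0 y -> ble 0 u ->
  ble (bmeet (x + y) u) (bmeet x u + bmeet y u).
Proof.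
move=> x0 y0 u0; rewrite -bleBl ble_meet; apply/andP; split; last first.
  rewrite bleBl (ble_tr (ble_meetr _ _))// -[X in ble X _]addr0.
  by rewrite bleD ?ble_refl// bmeet_ge0.
rewrite bleBl [x + bmeet _ _]addrC -bleBl ble_meet bleBl [y + x]addrC.
rewrite ble_meetl/= bleBl.
by rewrite (ble_tr (ble_meetr _ _))// -[X in ble X _]addr0 bleD ?ble_refl.
Qed.

Lemma norm_bmeetD x y u : ble 0 u ->
  `|bmeet (babs (x + y)) u| <= `|bmeet (babs x) u| + `|bmeet (babs y) u|.
Proof.
move=> u0; apply: le_trans (ler_normD _ _); apply: ble_norm.
  by rewrite bmeet_ge0 ?babs_ge0.
apply: ble_tr (bmeetDl (babs_ge0 _) (babs_ge0 _) u0).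
by rewrite bmeet_mono ?babsD ?ble_refl.
Qed.

End BanachLatticeTheory.

Definition tau_space (R : realType) (V : banachLatticeType R) : Type := V.

Section TauTopology.
Context (R : realType) (V : banachLatticeType R).
Implicit Types (x y z u : V) (a e : R).

HB.instance Definition _ := GRing.Lmodule.on (tau_space V).

Definition tau_ball x u e : set (tau_space V) :=
  [set y : V | `|bmeet (babs (y - x)) u| <= e].

Definition tau_nbhs (x : tau_space V) : set_system (tau_space V) :=
  [set A | exists u e, [/\ ble 0 u, 0 < e & tau_ball x u e `<=` A]].

HB.instance Definition _ := hasNbhs.Build (tau_space V) tau_nbhs.

Lemma tau_ball_center x u e : ble 0 u -> 0 < e -> tau_ball x u e x.
Proof.
move=> u0 /ltW e0; rewrite /tau_ball/= subrr babs0.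
suff -> : bmeet 0 u = 0 by rewrite normr0.
by apply: ble_anti; rewrite ble_meetl ble_meet u0 ble_refl.
Qed.

Lemma tau_ballD x y z u e e' : ble 0 u ->
  tau_ball x u e y -> tau_ball y u e' z -> tau_ball x u (e + e') z.
Proof.
move=> u0 xy yz; rewrite /tau_ball/= -(subrK y z) -addrA addrC.
by apply: le_trans (norm_bmeetD _ _ u0) _; apply: lerD.
Qed.

Lemma tau_nbhs_filter (x : tau_space V) : ProperFilter (nbhs x).
Proof.
split; first by case=> u [e [u0 e0]] /(_ x) /(_ (tau_ball_center x u0 e0)).
split.
- by exists 0, 1; rewrite ble_refl.
- move=> A B [u [e [u0 e0 uA]]] [v [d [v0 d0 vB]]].
  exists (u + v), (Num.min e d); split.
  + by rewrite -[0]addr0 bleD.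
  + by rewrite lt_min e0.
  + move=> y; rewrite /tau_ball/= le_min => /andP[ye yd].
    split; [apply: uA|apply: vB]; (apply: le_trans; last by [exact: ye|exact: yd]).
    * apply: ble_norm; first by rewrite bmeet_ge0 ?babs_ge0.
      by rewrite bmeet_mono ?ble_refl// -[X in ble X _]addr0 bleD ?ble_refl.
    * apply: ble_norm; first by rewrite bmeet_ge0 ?babs_ge0.
      by rewrite bmeet_mono ?ble_refl// -[X in ble X _]add0r bleD ?ble_refl.
- move=> A B AB [u [e [u0 e0 uA]]]; exists u, e; split => //.
  exact: subset_trans AB.
Qed.

Lemma tau_nbhs_singleton (x : tau_space V) A : nbhs x A -> A x.
Proof. by move=> [u [e [u0 e0]]]; apply; exact: tau_ball_center. Qed.

Lemma tau_nbhs_nbhs (x : tau_space V) A : nbhs x A -> nbhs x (nbhs^~ A).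
Proof.
move=> [u [e [u0 e0 uA]]]; exists u, (e / 2); split; [by []|lra|].
move=> y xy; exists u, (e / 2); split; [by []|lra|].
by move=> z yz; apply: uA; rewrite [e]splitr; exact: tau_ballD xy yz.
Qed.

HB.instance Definition _ := Nbhs_isNbhsTopological.Build (tau_space V)
  tau_nbhs_filter tau_nbhs_singleton tau_nbhs_nbhs.

Lemma tau_add_continuous :
  continuous (fun x : tau_space V * tau_space V => x.1 + x.2).
Proof.
move=> [x y] A [u [e [u0 e0 uA]]] /=.
exists (tau_ball x u (e / 2), tau_ball y u (e / 2)).
  by split; exists u, (e / 2); split=> //=; lra.
move=> [x' y'] [/= xx' yy']; apply: uA; rewrite [e]splitr /tau_ball/=.
rewrite opprD addrACA; apply: le_trans (norm_bmeetD _ _ u0) _.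
exact: lerD.
Qed.

HB.instance Definition _ :=
  PreTopologicalNmodule_isTopologicalNmodule.Build (tau_space V)
    tau_add_continuous.

Lemma tau_scale_continuous :
  continuous (fun z : R^o * tau_space V => z.1 *: z.2).
Proof.
move=> [k x] A [u [e [u0 e0 uA]]] /=.
pose M := `|k| + 1; have M1 : 1 <= M by rewrite lerDr.
have M0 : 0 < M by exact: lt_le_trans M1.
pose d := Num.min 1 (e / 2 / (`|(x : V)| + 1)).
have x1 : 0 < `|(x : V)| + 1 by rewrite ltr_wpDl.
have d0 : 0 < d by rewrite lt_min ltr01 divr_gt0// divr_gt0.
exists (ball (k : R^o) d, tau_ball x u (e / 2 / M)).
  split; first exact: nbhsx_ballx.
  by exists u, (e / 2 / M); split=> //; rewrite divr_gt0// divr_gt0.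
move=> [l y] [/= kl xy]; apply: uA; rewrite /tau_ball/= [e]splitr.
have -> : l *: (y : V) - k *: (x : V) = l *: ((y : V) - x) + (l - k) *: (x : V).
  by rewrite scalerBr scalerBl addrA subrK.
have {}kl : `|l - k| <= d by rewrite distrC ltW.
apply: le_trans (norm_bmeetD _ _ u0) _; apply: lerD; last first.
  apply: (@le_trans _ _ (`|(l - k) *: (x : V)|)).
    apply: bnorm_mono; rewrite -/(babs _) -/(babs ((l - k) *: _)).
    by rewrite babs_id ?ble_meetl// bmeet_ge0 ?babs_ge0.
  rewrite normrZ; apply: (@le_trans _ _ (d * (`|(x : V)| + 1))).
    by rewrite ler_pM// lerDl.
  by rewrite -ler_pdivlMr// ge_min lexx orbT.
have lM : `|l| <= M.
  have d1 : d <= 1 by rewrite ge_min lexx.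
  rewrite -[l](subrK k) (le_trans (ler_normD _ _))// addrC lerD//.
  exact: le_trans d1.
apply: (@le_trans _ _ `|M *: bmeet (babs ((y : V) - x)) u|); last first.
  by rewrite normrZ gtr0_norm// mulrC -ler_pdivlMr.
apply: ble_norm; first by rewrite bmeet_ge0 ?babs_ge0.
have Mi : 0 <= M^-1 by rewrite invr_ge0 ltW.
have blM z (r s : R) : ble 0 z -> r <= s -> ble (r *: z) (s *: z).
  move=> z0 rs; rewrite -(subrK r s) scalerDl -[X in ble X _]add0r.
  by rewrite bleD ?ble_refl// -[0](scaler0 _ (s - r)) bleZ// subr_ge0.
rewrite -[X in ble X _](scale1r) -(mulfV (lt0r_neq0 M0)) -scalerA bleZ// ?ltW//.
rewrite ble_meet; apply/andP; split.
  rewrite -[X in ble _ X](scale1r) -(mulVf (lt0r_neq0 M0)) -scalerA bleZ//.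
  apply: ble_tr (ble_meetl _ _) (ble_tr (babsZ _ _) _).
  by rewrite blM ?babs_ge0.
rewrite -[X in ble _ X](scale1r).
apply: (@ble_tr _ _ (M^-1 *: u)); first by rewrite bleZ// ble_meetr.
by rewrite blM// invf_le1.
Qed.

HB.instance Definition _ :=
  TopologicalNmodule_isTopologicalLmodule.Build R (tau_space V)
    tau_scale_continuous.

Lemma tau_norm_bmeet_continuous0 u :
  {for (0 : tau_space V),
    continuous (fun x : tau_space V => `|bmeet (babs (x : V)) (babs u)| : R^o)}.
Proof.
have b0 : bmeet (babs (0 : V)) (babs u) = 0.
  by rewrite babs0; apply: ble_anti; rewrite ble_meetl ble_meet babs_ge0 ble_refl.
rewrite /prop_for /continuous_at b0 normr0.
apply/(@cvgrPdist_le _ _ _ (nbhs (0 : tau_space V))) => e e0; exists (babs u), e; split; [exact: babs_ge0|by []|].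
by move=> y; rewrite /tau_ball/= subr0 sub0r normrN normr_id.
Qed.

(* Together with the three facts above, this says that the topology of
   [tau_space V] is the coarsest linear topology for which the maps
   x |-> `| |x| /\ |u| | are continuous at 0: a linear topology on V with that
   property is a topological module T with a linear bijection j : T -> V. *)
Lemma tau_coarsest (T : topologicalLmodType R) (j : {linear T -> V}) :
  (forall u, {for 0, continuous
     (fun t : T => `|bmeet (babs (j t)) (babs u)| : R^o)}) ->
  continuous (j : T -> tau_space V).
Proof.
move=> jc t A [u [e [u0 e0 uA]]].
have := jc u; rewrite /prop_for /continuous_at (linear0 j).
have -> : bmeet (babs (0 : V)) (babs u) = 0.
  by rewrite babs0; apply: ble_anti; rewrite ble_meetl ble_meet babs_ge0 ble_refl.
rewrite normr0 => /cvgrPdist_le/(_ e e0) je.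
have st : (fun s : T => s - t) @ t --> (0 : T).
  rewrite -(subrr t).
  apply: (@continuous_comp _ _ _ (fun s : T => (s, t))
    (fun x : T * T => x.1 - x.2)); last exact: sub_continuous.
  by apply: cvg_pair; [exact: cvg_id|exact: cvg_cst].
apply: (@filterS _ (nbhs t) _ _ _ _ (st _ je)) => s /=.
by rewrite sub0r normrN normr_id linearB (babs_id u0) => ?; exact: uA.
Qed.

Lemma tau_cvgP (x_ : nat -> tau_space V) (x : tau_space V) :
  x_ @ \oo --> x <-> forall u, ble 0 u ->
    (fun n => `|bmeet (babs ((x_ n : V) - x)) u| : R^o) @ \oo --> (0 : R^o).
Proof.
split=> [xx u u0|xx A [u [e [u0 e0 uA]]]].
  apply/cvgrPdist_le => e e0; have : nbhs x (tau_ball x u e).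
    by exists u, e; split=> //.
  by move=> /xx; apply: (@filterS _ \oo) => n; rewrite /tau_ball/= sub0r normrN normr_id.
have /cvgrPdist_le/(_ e e0) := xx u u0.
by apply: (@filterS _ \oo) => n /=; rewrite sub0r normrN normr_id; exact: uA.
Qed.

End TauTopology.

Section LowerEstimate.
Context (R : realType) (V : banachLatticeType R).
Implicit Types (x : V) (p : R).

Definition disjoint_family n (f : 'I_n -> V) :=
  forall i j, i != j -> bdisjoint (f i) (f j).

Definition lower_estimate p := exists C : R,
  forall n (f : 'I_n -> V), disjoint_family f ->
    (\sum_(i < n) `|f i| `^ p) `^ p^-1 <= C * `|\sum_(i < n) f i|.

Definition norm0_set p x : set R :=
  [set s | exists n (f : 'I_n -> V),
    [/\ disjoint_family f, x = \sum_(i < n) f i &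
        s = (\sum_(i < n) `|f i| `^ p) `^ p^-1]].

Definition norm0 p x : R := sup (norm0_set p x).

(* [sup] is 0 on sets without a finite supremum; here it is a true supremum. *)
Lemma norm0_has_sup p x : lower_estimate p -> has_sup (norm0_set p x).
Proof.
move=> [C hC]; split; last first.
  by exists (C * `|x|) => _ [n [f [fd -> ->]]]; exact: hC.
exists ((\sum_(i < 1) `|x| `^ p) `^ p^-1), 1%N, (fun=> x).
by split=> // [i j|]; [rewrite !ord1|rewrite big_ord1].
Qed.

Definition tau_UKK (N : V -> R) := forall eps : R, 0 < eps ->
  exists2 delta : R, 0 < delta &
    forall (x_ : nat -> tau_space V) (x : tau_space V),
      (forall n, N (x_ n) <= 1) ->
      eps <= inf [set N (x_ nm.1 - x_ nm.2) |
                   nm in [set nm : nat * nat | nm.1 != nm.2]] ->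
      x_ @ \oo --> x ->
      N x <= 1 - delta.

End LowerEstimate.

Arguments lower_estimate {R} V p.

(* Main.v *)
(* If y = x_n - x overlaps little with x, in the sense that w = |x| /\ |y| has
   small norm, then shrinking y and the members x_i of a disjoint decomposition
   of x towards 0 by w yields a genuinely disjoint family.  Band projections
   onto its members turn it into an exact disjoint decomposition of x_n whose
   terms are close to the x_i and y.  Hence sum_i |x_i|^p + |y|^p <= 1 in the
   limit, and |y| is bounded below because the norms | | and | |_0 are
   equivalent and the sequence is separated.  The band projection of z onto u
   is the limit of z /\ n u, which is norm-Cauchy because otherwise truncations
   of its increments would be infinitely many disjoint elements below z, bounded
   away from 0. *)

Require Import Defs.
From mathcomp Require Import all_boot all_order all_algebra.
From mathcomp Require Import boolp classical_sets reals.
From mathcomp Require Import topology normedtype sequences exp.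
From mathcomp Require Import lra.
Import Order.TTheory GRing.Theory Num.Theory.
Import numFieldNormedType.Exports.
Set Implicit Arguments.
Unset Strict Implicit.
Unset Printing Implicit Defensive.

Local Open Scope classical_set_scope.
Local Open Scope ring_scope.

Lemma powR_one (R : realType) (r : R) : 1 `^ r = 1 :> R.
Proof. by rewrite powR1. Qed.

(** * Order and disjointness calculus in a Banach lattice *)

Section BanachLatticeCalculus.
Context (R : realType) (V : banachLatticeType R).
Implicit Types (x y z u v w a b c : V).

Lemma bleBr x y z : ble x (y - z) = ble (x + z) y.
Proof. by rewrite -[in RHS](opprK z) bleBl. Qed.

Lemma bsubr_ge0 x y : ble 0 (y - x) = ble x y.
Proof. by rewrite bleBr add0r. Qed.

Lemma bleN2 x y : ble (- x) (- y) = ble y x.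
Proof. by rewrite -[- x]add0r bleBl addrC bsubr_ge0. Qed.

Lemma bleDl x y : ble 0 y -> ble x (x + y).
Proof. by move=> y0; rewrite -{1}[x]addr0 bleD ?ble_refl. Qed.

Lemma bleBDl x y : ble 0 y -> ble (x - y) x.
Proof. by move=> y0; rewrite bleBl bleDl. Qed.

Lemma ble0_anti x : ble 0 x -> ble x 0 -> x = 0.
Proof. by move=> x0 x0'; apply: ble_anti; rewrite x0 x0'. Qed.

Lemma bmeetC x y : bmeet x y = bmeet y x.
Proof. by apply: ble_anti; rewrite !ble_meet !ble_meetl !ble_meetr. Qed.

Lemma blerZ x (r s : R) : ble 0 x -> r <= s -> ble (r *: x) (s *: x).
Proof.
move=> x0 rs; rewrite -bsubr_ge0 -scalerBl -[0](scaler0 _ (s - r)).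
by rewrite bleZ// subr_ge0.
Qed.

Lemma ble_abs x : ble x (babs x). Proof. exact: ble_joinl. Qed.

Lemma babs_babs x : babs (babs x) = babs x.
Proof. by rewrite babs_id ?babs_ge0. Qed.

Lemma norm_babs x : `|babs x| = `|x|.
Proof.
by apply/eqP; rewrite eq_le !bnorm_mono// -/(babs x) -/(babs (babs x)) babs_babs
  ble_refl.
Qed.

Lemma norm_babs_le x y : ble (babs x) y -> `|x| <= `|y|.
Proof. by move=> xy; rewrite -norm_babs ble_norm ?babs_ge0. Qed.

Lemma bdisjC x y : bdisjoint x y -> bdisjoint y x.
Proof. by rewrite /bdisjoint bmeetC. Qed.

Lemma bdisj_le x a y : ble (babs a) (babs x) -> bdisjoint x y -> bdisjoint a y.
Proof.
move=> ax xy; apply: ble0_anti; first by rewrite bmeet_ge0 ?babs_ge0.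
by rewrite -xy bmeet_mono ?ble_refl.
Qed.

Lemma bdisjD a b y : bdisjoint a y -> bdisjoint b y -> bdisjoint (a + b) y.
Proof.
move=> ay b_y; apply: ble0_anti; first by rewrite bmeet_ge0 ?babs_ge0.
have := bmeetDl (babs_ge0 a) (babs_ge0 b) (babs_ge0 y).
by rewrite ay b_y addr0; apply: ble_tr; rewrite bmeet_mono ?babsD ?ble_refl.
Qed.

Lemma bdisjN a y : bdisjoint a y -> bdisjoint (- a) y.
Proof. by rewrite /bdisjoint babsN. Qed.

Lemma bdisjB a b y : bdisjoint a y -> bdisjoint b y -> bdisjoint (a - b) y.
Proof. by move=> ay b_y; apply: bdisjD => //; exact: bdisjN. Qed.

Lemma bdisj0 y : bdisjoint 0 y.
Proof.
apply: ble0_anti; first by rewrite bmeet_ge0 ?babs_ge0.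
by rewrite babs0 ble_meetl.
Qed.

Lemma bdisj_sum (I : Type) (s : seq I) (P : pred I) (f : I -> V) y :
  (forall i, P i -> bdisjoint (f i) y) -> bdisjoint (\sum_(i <- s | P i) f i) y.
Proof.
move=> fy; elim/big_ind: _ => //; first exact: bdisj0.
by move=> a b; exact: bdisjD.
Qed.

(** Since a = (a + b) - b, |a| lies below |a + b| + |b|. Meeting with |a| and splitting the meet
    over the sum kills the |b| term. *)
Lemma bdisj_babsD a b : bdisjoint a b -> ble (babs a) (babs (a + b)).
Proof.
move=> ab; have le : ble (babs a) (babs (a + b) + babs b).
  by rewrite -{1}(addrK b a) -(babsN b) babsD.
have := bmeetDl (babs_ge0 (a + b)) (babs_ge0 b) (babs_ge0 a).
rewrite [bmeet (babs b) _]bmeetC ab addr0 => h.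
apply: ble_tr (ble_meetl _ (babs a)); apply: ble_tr h.
by rewrite ble_meet le ble_refl.
Qed.

(** If m is the meet of the two remainders, then m + x /\ y lies below both x and y, hence below x
    /\ y. *)
Lemma bmeet_subl_disjoint x y :
  bmeet (x - bmeet x y) (y - bmeet x y) = 0.
Proof.
apply: ble0_anti; first by rewrite bmeet_ge0 ?bsubr_ge0 ?ble_meetl ?ble_meetr.
set m := bmeet (_ - _) _; rewrite -(subrr (bmeet x y)) bleBr ble_meet.
by rewrite -!bleBr ble_meetl ble_meetr.
Qed.

Lemma bdisj_of_le x y a b : ble (babs x) a -> ble (babs y) b ->
  bmeet a b = 0 -> bdisjoint x y.
Proof.
move=> xa yb ab; apply: ble0_anti; first by rewrite bmeet_ge0 ?babs_ge0.
by rewrite -ab bmeet_mono.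
Qed.

(** Passes order relations to norm limits: y \/ 0 lies below |f n - x|, so its norm is at most any e
    > 0. *)
Lemma ble0_cvg x y (f : nat -> V) : f @ \oo --> x ->
  (\forall n \near \oo, ble y (babs (f n - x))) -> ble y 0.
Proof.
move=> fx yf; suff -> : 0 = bjoin y 0 by exact: ble_joinl.
apply/esym/eqP; rewrite -normr_le0; apply/ler_addgt0Pr => e e0; rewrite add0r.
have /cvgrPdist_le/(_ e e0) fxe := fx.
have [N _ /(_ N (leqnn N)) /= [yN]] := filterI yf fxe.
apply: le_trans; rewrite distrC -[leRHS]norm_babs ble_norm ?ble_joinr//.
by rewrite ble_join yN babs_ge0.
Qed.

Lemma bmeetZ_mono z u (r s : R) : ble 0 u -> r <= s ->
  ble (bmeet z (r *: u)) (bmeet z (s *: u)).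
Proof. by move=> u0 rs; rewrite bmeet_mono ?ble_refl ?blerZ. Qed.

End BanachLatticeCalculus.

(** * Band projections under a lower p-estimate *)

Section BandProjection.
Context (R : realType) (V : banachLatticeType R) (p : R).
Hypotheses (p1 : 1 <= p) (hV : lower_estimate V p).
Implicit Types (x y z u v w a b c : V).

Let p0 : 0 < p. Proof. exact: lt_le_trans p1. Qed.

Lemma powRVK (r : R) : 0 <= r -> (r `^ p^-1) `^ p = r.
Proof. by move=> r0; rewrite -powRrM mulVf ?gt_eqF// powRr1. Qed.

Lemma lower_estimate_card : exists2 C : R, 0 < C &
  forall n (f : 'I_n -> V), disjoint_family f ->
    \sum_(i < n) `|f i| `^ p <= (C * `|\sum_(i < n) f i|) `^ p.
Proof.
have [C hC] := hV; exists (`|C| + 1); first by rewrite ltr_wpDl.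
move=> n f fd; have s0 : 0 <= \sum_(i < n) `|f i| `^ p.
  by rewrite sumr_ge0// => i _; rewrite powR_ge0.
rewrite -[leLHS]powRVK// ge0_ler_powR ?nnegrE ?powR_ge0 ?(ltW p0)//.
  by rewrite mulr_ge0// addr_ge0.
apply: le_trans (hC _ _ fd) _; rewrite ler_wpM2r// (le_trans (ler_norm C))//.
by rewrite lerDl.
Qed.

(** The lower estimate applied to n of the terms gives n d^p <= (C |z|)^p, which fails for large
    n. *)
Lemma bounded_disjoint_not_bounded_below z (e : nat -> V) (d : R) :
  0 < d -> (forall k, d <= `|e k|) ->
  (forall j k, (j < k)%N -> bdisjoint (e j) (e k)) ->
  (forall n, ble 0 (\sum_(k < n) e k)) ->
  (forall n, ble (\sum_(k < n) e k) z) -> False.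
Proof.
move=> d0 de ed e0 ez; have [C C0 hC] := lower_estimate_card.
have dp : 0 < d `^ p by exact: powR_gt0.
set M := (C * `|z|) `^ p.
have [n nM] : exists n : nat, M < n%:R * d `^ p.
  exists (Num.truncn (M / d `^ p)).+1; rewrite -ltr_pdivrMr//.
  exact: truncnS_gt.
have fd : disjoint_family (fun i : 'I_n => e i).
  move=> i j; rewrite neq_ltn => /orP[|] ij; first exact: ed.
  by apply: bdisjC; exact: ed.
suff : n%:R * d `^ p <= M by rewrite leNgt nM.
apply: (@le_trans _ _ (\sum_(i < n) `|e i| `^ p)).
  rewrite mulr_natl -[n in leLHS]card_ord -sumr_const ler_sum// => i _.
  by rewrite ge0_ler_powR ?nnegrE ?(ltW p0) ?(ltW d0).
apply: le_trans (hC _ _ fd) _.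
rewrite ge0_ler_powR ?nnegrE ?(ltW p0)// ?mulr_ge0 ?(ltW C0)//.
by rewrite ler_wpM2l ?(ltW C0)// ble_norm.
Qed.

(** Otherwise the increasing sequence z /\ n u has successive increments [d k] of norm at least e.
    Cutting z / K off each leaves disjoint [f k] of norm at least e / 2, whose sums telescope below
    z. *)
Lemma cauchy_bmeet_scale z u : ble 0 z -> ble 0 u -> forall e : R, 0 < e ->
  exists n : nat, forall m : nat, (n <= m)%N ->
    `|bmeet z (m%:R *: u) - bmeet z (n%:R *: u)| < e.
Proof.
move=> z0 u0 e e0; set g := fun n : nat => bmeet z (n%:R *: u).
have gmono m n : (m <= n)%N -> ble (g m) (g n).
  by move=> mn; rewrite bmeetZ_mono// ler_nat.
have gz n : ble (g n) z by exact: ble_meetl.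
apply: contrapT => /forallNP nC.
have {nC} /choice [m mP] : forall n, exists m, (n <= m)%N /\ e <= `|g m - g n|.
  move=> n; apply: contrapT => /forallNP h; apply: (nC n) => m nm.
  by rewrite ltNge; apply/negP => em; exact: (h m).
(* K is large enough that z / K costs at most half of e. *)
pose K : nat := (Num.truncn (`|z| * 2 / e)).+1.
have K0 : 0 < K%:R :> R by rewrite ltr0n.
have KI : 0 <= K%:R^-1 :> R by rewrite invr_ge0 ltW.
have zK : `|K%:R^-1 *: z| <= e / 2.
  rewrite normrZ ger0_norm// mulrC ler_pdivrMr//.
  have : `|z| * 2 / e < K%:R by exact: truncnS_gt.
  rewrite ltr_pdivrMr// => h; apply: ltW; lra.
(* The factor K makes m (n_ k) u equal to (1/K) n_ k.+1 u, which matches the truncation by z / K in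
   [f_low]. *)
pose n_ k := iter k (fun n => K * m n)%N 0%N.
have n_S k : n_ k.+1 = (K * m (n_ k))%N by [].
have mn k : (m (n_ k) <= n_ k.+1)%N by rewrite n_S leq_pmull.
have n_mono k j : (k <= j)%N -> (n_ k <= n_ j)%N.
  apply: (homo_leq (f := n_) (r := leq)) => //; first exact: leq_trans.
  by move=> i; apply: leq_trans (mn i); case: (mP (n_ i)).
pose d k := g (m (n_ k)) - g (n_ k).
have d0 k : ble 0 (d k) by rewrite bsubr_ge0 gmono//; case: (mP (n_ k)).
pose f k := bjoin (d k - K%:R^-1 *: z) 0.
have f0 k : ble 0 (f k) by exact: ble_joinr.
have fd k : ble (f k) (d k).
  by rewrite ble_join d0 bleBDl// -[0](scaler0 _ K%:R^-1) bleZ.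
(* [f k] lives where [z] is below [n_ k.+1 *: u], and the later [f j] where it
   is above. *)
have f_low k : ble (f k) ((n_ k.+1)%:R *: u - g (n_ k.+1)).
  rewrite ble_join bsubr_ge0 ble_meetr andbT.
  set L := (n_ k.+1)%:R; set t := L *: u - _.
  have t0 : ble 0 t by rewrite bsubr_ge0 ble_meetr.
  apply: (@ble_tr _ _ (K%:R^-1 *: t)); last first.
    rewrite -[X in ble _ X]scale1r blerZ// invf_le1// ler1n//.
  rewrite bleBl -scalerDr.
  apply: (@ble_tr _ _ ((m (n_ k))%:R *: u)).
    apply: ble_tr (ble_meetr z _); rewrite bleBDl// ble_meet z0 /=.
    by rewrite -[0](scaler0 _ (n_ k)%:R) bleZ.
  have -> : (m (n_ k))%:R *: u = K%:R^-1 *: (L *: u).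
    by rewrite scalerA /L n_S natrM mulKf ?gt_eqF.
  by rewrite bleZ// -addrA [- _ + z]addrC bleDl// bsubr_ge0.
have f_high k j : (k < j)%N -> ble (f j) (z - g (n_ k.+1)).
  move=> kj; apply: ble_tr (fd j) _.
  by apply: bleD => //; rewrite bleN2 gmono// n_mono.
apply: (@bounded_disjoint_not_bounded_below z f (e / 2)).
- by rewrite divr_gt0.
- move=> k; have : e <= `|d k| by case: (mP (n_ k)).
  have : `|d k| <= `|f k| + `|K%:R^-1 *: z|.
    apply: le_trans (ler_normD _ _); apply: ble_norm => //.
    by rewrite -bleBl ble_joinl.
  move: zK; lra.
- move=> k j kj; apply: (bdisj_of_le (a := (n_ k.+1)%:R *: u - g (n_ k.+1))
    (b := z - g (n_ k.+1))).
  + by rewrite babs_id// f_low.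
  + by rewrite babs_id// f_high.
  + by rewrite bmeetC; exact: bmeet_subl_disjoint.
- by move=> n; elim/big_ind: _ => [|a b a0 b0|//]; rewrite ?ble_refl// -[0]addr0 bleD.
(* Telescoping: adding [f n], which is below [d n], raises the bound from [g (n_ n)] to at most
   [g (m (n_ n))]. *)
- move=> n; apply: (@ble_tr _ _ (g (n_ n))) => //.
  elim: n => [|n IHn].
    by rewrite big_ord0 ble_meet z0 -[X in ble X _](scaler0 _ (n_ 0)%:R) bleZ.
  rewrite big_ord_recr /=; apply: ble_tr (gmono _ _ (mn n)).
  by rewrite -(subrK (g (n_ n)) (g (m _))) addrC bleD.
Qed.

Lemma band_projection_ge0 z u : ble 0 z -> ble 0 u -> exists b,
  [/\ ble 0 b, ble b z, bmeet (z - b) u = 0 &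
      forall a, ble 0 a -> bmeet u a = 0 -> bmeet b a = 0].
Proof.
move=> z0 u0; set g := fun n : nat => bmeet z (n%:R *: u).
have gmono m n : (m <= n)%N -> ble (g m) (g n).
  by move=> mn; rewrite bmeetZ_mono// ler_nat.
have g0 n : ble 0 (g n) by rewrite ble_meet z0 -[0](scaler0 _ n%:R) bleZ.
have : cvg (g @ \oo).
  apply/cauchy_cvgP/cauchy_exP => e e0.
  have [n hn] := cauchy_bmeet_scale z0 u0 e0.
  by exists (g n); exists n => // k /= nk; rewrite -ball_normE/= distrC; exact: hn.
set b := lim _ => gb; exists b.
have gleb n : ble (g n) b.
  rewrite -bsubr_ge0 -(opprB (g n)) -[0]oppr0 bleN2.
  apply: (ble0_cvg gb); exists n => // k /= nk.
  by apply: ble_tr (ble_abs _); rewrite bleD ?ble_refl ?gmono.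
have bz : ble b z.
  rewrite -bsubr_ge0 -(opprB b) -[0]oppr0 bleN2.
  apply: (ble0_cvg gb); exists 0%N => // k /= _.
  rewrite -babsN opprB; apply: ble_tr (ble_abs _).
  by rewrite bleD ?ble_refl// bleN2 ble_meetl.
split=> //; first exact: ble_tr (g0 0%N) (gleb 0%N).
  (* v + g k lies below both z and (k + 1) u, hence below g (k + 1) and b. So v is below b - g k,
     which tends to 0. *)
  set v := bmeet _ _; have v0 : ble 0 v by rewrite bmeet_ge0 ?bsubr_ge0.
  apply: ble0_anti => //; apply: (ble0_cvg gb); exists 0%N => // k /= _.
  rewrite -babsN opprB; apply: ble_tr (ble_abs _); rewrite bleBr.
  apply: ble_tr (gleb k.+1); rewrite ble_meet addrC; apply/andP; split.
    rewrite -(subrK b z) addrC; apply: bleD; [exact: ble_meetl|exact: gleb].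
  rewrite -natr1 scalerDl scale1r.
  by apply: bleD; [exact: ble_meetr|exact: ble_meetr].
move=> a a0 ua; have b0 : ble 0 b by exact: ble_tr (g0 0%N) (gleb 0%N).
apply: ble0_anti; first exact: bmeet_ge0.
have na n : bmeet (n%:R *: u) a = 0.
  elim: n => [|n IHn].
    by apply: ble0_anti; rewrite scale0r ?ble_meetl// bmeet_ge0 ?ble_refl.
  have nu0 : ble 0 (n%:R *: u) by rewrite -[0](scaler0 _ n%:R) bleZ.
  apply: ble0_anti; rewrite -natr1 scalerDl scale1r.
    by rewrite bmeet_ge0// -[0]addr0 bleD.
  by have := bmeetDl nu0 u0 a0; rewrite IHn ua addr0.
(* b /\ a is at most (b - g k) /\ a + g k /\ a, and the last meet vanishes because g k lies below k
   u. *)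
apply: (ble0_cvg gb); exists 0%N => // k /= _.
rewrite -babsN opprB; apply: ble_tr (ble_abs _).
have bk : ble 0 (b - g k) by rewrite bsubr_ge0.
have := bmeetDl bk (g0 k) a0; rewrite subrK => h.
apply: (ble_tr h); rewrite -[X in ble _ X]addr0 bleD ?ble_meetl//.
by rewrite -(na k) bmeet_mono ?ble_refl ?ble_meetr.
Qed.

(** Project the positive elements |z| and |z| - z separately and subtract. The second clause places
    b in the band generated by u. *)
Lemma band_projection z u : exists b,
  bdisjoint (z - b) u /\ forall a, bdisjoint u a -> bdisjoint b a.
Proof.
have z'0 : ble 0 (babs z - z) by rewrite bsubr_ge0 ble_abs.
have [b [b0 bz bu bP]] := band_projection_ge0 (babs_ge0 z) (babs_ge0 u).
have [c [c0 cz cu cP]] := band_projection_ge0 z'0 (babs_ge0 u).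
exists (b - c); split.
  have -> : z - (b - c) = (babs z - b) - ((babs z - z) - c).
    by rewrite !opprB [RHS]addrC -[RHS]addrA subrKA addrCA.
  by apply: bdisjB; rewrite /bdisjoint babs_id// bsubr_ge0.
move=> a ua; apply: bdisjB.
  by rewrite /bdisjoint (babs_id b0) bP ?babs_ge0.
by rewrite /bdisjoint (babs_id c0) cP ?babs_ge0.
Qed.

(** Each [b i] is the projection of z onto the band of [v i]. The error z - sum v splits as (b i - v
    i) + a with both summands disjoint, so it dominates b i - v i. *)
Lemma disjoint_splitting n (v : 'I_n -> V) z : disjoint_family v ->
  exists b : 'I_n -> V, [/\ disjoint_family b,
    forall i, bdisjoint (b i) (z - \sum_j b j) &
    forall i, `|v i - b i| <= `|z - \sum_j v j|].
Proof.
move=> vd; have /choice [b bP] := fun i => band_projection z (v i).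
have bv i a : bdisjoint (v i) a -> bdisjoint (b i) a by exact: (bP i).2.
have bd : disjoint_family b.
  by move=> i j ij; apply/bv/bdisjC/bv/vd; rewrite eq_sym.
exists b; split=> // i.
  apply/bv/bdisjC; rewrite (bigD1 i)//= opprD addrA.
  apply: bdisjB; first exact: (bP i).1.
  by apply: bdisj_sum => j ji; apply: bv; exact: vd.
pose a := z - b i - \sum_(j | j != i) v j.
have av : bdisjoint a (v i).
  by apply: bdisjB; [exact: (bP i).1|apply: bdisj_sum => j ji; exact: vd].
rewrite distrC; apply: bnorm_mono.
have -> : z - \sum_j v j = (b i - v i) + a.
  rewrite /a (bigD1 i)//= opprD [LHS]addrA [RHS]addrA; congr (_ - _).
  by rewrite [RHS]addrC subrKA.
apply: bdisj_babsD; apply: bdisjB; last exact: bdisjC.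
by apply: bv; exact: bdisjC.
Qed.

(** * The norm [norm0] and almost disjoint families *)

Lemma sum_powR_le_norm0 n (f : 'I_n -> V) : disjoint_family f ->
  \sum_(i < n) `|f i| `^ p <= norm0 p (\sum_(i < n) f i) `^ p.
Proof.
move=> fd; have s0 : 0 <= \sum_(i < n) `|f i| `^ p.
  by rewrite sumr_ge0// => i _; rewrite powR_ge0.
have le : (\sum_(i < n) `|f i| `^ p) `^ p^-1 <= norm0 p (\sum_(i < n) f i).
  apply: sup_upper_bound; first exact: norm0_has_sup.
  by exists n, f.
rewrite -[leLHS]powRVK// ge0_ler_powR ?nnegrE ?powR_ge0 ?(ltW p0)//.
by apply: le_trans le; rewrite powR_ge0.
Qed.

Lemma norm0_ge0 x : 0 <= norm0 p x.
Proof.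
have [s xs] : norm0_set p x !=set0 by case: (norm0_has_sup x hV).
apply: (@le_trans _ _ s); first by case: xs => n [f [_ _ ->]]; exact: powR_ge0.
by apply: sup_upper_bound => //; exact: norm0_has_sup.
Qed.

Lemma norm0_le_norm : exists2 C : R, 0 < C & forall x, norm0 p x <= C * `|x|.
Proof.
have [C C0 hC] := lower_estimate_card; exists C => // x.
apply: ge_sup => [|_ [n [f [fd -> ->]]]]; first by case: (norm0_has_sup x hV).
have Cx : 0 <= C * `|\sum_(i < n) f i| by rewrite mulr_ge0// ltW.
rewrite -[leRHS]powRr1// -(mulfV (lt0r_neq0 p0)) powRrM.
by rewrite ge0_ler_powR ?nnegrE ?powR_ge0 ?invr_ge0 ?(ltW p0)// ?hC//
  sumr_ge0// => i _; rewrite powR_ge0.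
Qed.

(** Splitting sum g along v moves each [v i] by at most n s, and [g i] is within s of [v i]: the
    total loss is (n + 1) s. The maximum with 0 keeps the bases nonnegative, where powers are
    monotone. *)
Lemma sum_powR_almost_disjoint n (g v : 'I_n -> V) (s : R) :
  disjoint_family v -> (forall i, `|g i - v i| <= s) ->
  \sum_(i < n) Num.max (`|g i| - n.+1%:R * s) 0 `^ p <=
    norm0 p (\sum_(i < n) g i) `^ p.
Proof.
move=> vd gv; have [b [bd br bv]] := disjoint_splitting (\sum_i g i) vd.
(* The remainder of the splitting goes to index 0, so that h decomposes sum g exactly. *)
pose h (i : 'I_n.+1) := oapp b (\sum_i g i - \sum_i b i) (unlift ord0 i).
have hl i : h (lift ord0 i) = b i by rewrite /h liftK.
have hS : \sum_i h i = \sum_i g i.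
  by rewrite big_ord_recl (eq_bigr _ (fun i _ => hl i)) /h unlift_none /= subrK.
have hd : disjoint_family h.
  move=> i j; rewrite /h.
  case: (unliftP ord0 i) => [i'|] ->; case: (unliftP ord0 j) => [j'|] -> /=.
  - by rewrite (inj_eq lift_inj) => /bd.
  - by move=> _; exact: br.
  - by move=> _; apply: bdisjC; exact: br.
  - by [].
rewrite -hS; apply: le_trans (sum_powR_le_norm0 hd).
rewrite big_ord_recl; under [X in _ <= _ + X]eq_bigr do rewrite hl.
apply: (@le_trans _ _ (\sum_i `|b i| `^ p)); last by rewrite lerDr powR_ge0.
apply: ler_sum => i _; rewrite ge0_ler_powR ?nnegrE ?(ltW p0)//.
  by rewrite le_max lexx orbT.
rewrite ge_max normr_ge0 andbT.
have r : `|\sum_i g i - \sum_i v i| <= n%:R * s.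
  rewrite -sumrB mulr_natl -[n in leRHS]card_ord -sumr_const.
  by apply: le_trans (ler_norm_sum _ _ _) _; apply: ler_sum.
have := le_trans (bv i) r; have := gv i; rewrite -natr1 mulrDl mul1r.
have := ler_normD (g i - v i) (v i - b i + b i).
have := ler_normD (v i - b i) (b i).
rewrite !subrK; lra.
Qed.

End BandProjection.

(** * Truncation and passage to the limit *)

Section Truncation.
Context (R : realType) (V : banachLatticeType R).
Implicit Types (x w : V).

(** Soft thresholding: for positive w, x is moved towards 0 by at most w. *)
Definition btrunc w x : V := bjoin (x - w) 0 - bjoin (- x - w) 0.

Lemma babs_btrunc w x : ble (babs (btrunc w x)) (bjoin (babs x - w) 0).
Proof.
have le y : ble y (babs x) -> ble (bjoin (y - w) 0) (bjoin (babs x - w) 0).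
  move=> yx; rewrite ble_join ble_joinr andbT; apply: ble_tr (ble_joinl _ _).
  by rewrite bleD ?ble_refl.
rewrite ble_join opprB; apply/andP; split.
  by apply: ble_tr (le _ (ble_abs x)); rewrite bleBDl ?ble_joinr.
by apply: ble_tr (le _ (ble_joinr _ _)); rewrite bleBDl ?ble_joinr.
Qed.

Lemma babs_sub_btrunc w x : ble 0 w -> ble (babs (x - btrunc w x)) w.
Proof.
(* Truncation is odd in x, so one one-sided bound gives both. *)
move=> w0; suff le y : ble (y - btrunc w y) w.
  rewrite ble_join le opprB /=; have := le (- x).
  by rewrite /btrunc opprK opprB addrC.
rewrite /btrunc bleBl addrA bleBr [y + _]addrC -bleBr ble_join !bleBr add0r.
rewrite [- y - w]addrC subrK; apply/andP; split; last first.
  by rewrite addrC -bleBl ble_joinl.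
apply: (@ble_tr _ _ 0); first by rewrite -[0]oppr0 bleN2.
by apply: ble_tr w0 _; apply: bleDl; exact: ble_joinr.
Qed.

End Truncation.

(** Subtraction is compared with scaling: for theta < 1 and t small, theta a_i is at most max (a_i -
    t) 0. Then theta tends to 1. *)
Lemma sum_powR_le1_of_sub (R : realType) (p : R) n (a : 'I_n -> R) :
  0 < p -> (forall i, 0 <= a i) ->
  (forall t : R, 0 < t -> \sum_(i < n) Num.max (a i - t) 0 `^ p <= 1) ->
  \sum_(i < n) a i `^ p <= 1.
Proof.
move=> p0 a0 ha; set S := \sum_(i < n) _.
have S0 : 0 <= S by rewrite sumr_ge0// => i _; exact: powR_ge0.
have le1 (r : R) : 0 <= r -> r `^ p <= 1 -> r <= 1.
  move=> r0; rewrite leNgt => rp; rewrite leNgt; apply: contra rp => r1.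
  by rewrite -[X in X < _](powR_one p) gt0_ltr_powR ?nnegrE.
have SE : (S `^ p^-1) `^ p = S by rewrite -powRrM mulVf ?gt_eqF// powRr1.
suff scaled theta : 0 < theta -> theta < 1 -> theta * S `^ p^-1 <= 1.
  rewrite -SE -[X in _ <= X](powR_one p) ge0_ler_powR ?nnegrE ?(ltW p0) ?powR_ge0//.
  set s := S `^ p^-1; rewrite leNgt; apply/negP => s1.
  have s0 : 0 < s by lra.
  have si1 : s^-1 < 1 by rewrite invf_lt1.
  have si0 : 0 < s^-1 by rewrite invr_gt0.
  (* If s > 1, this theta is below 1 and yet theta s = (s + 1) / 2 exceeds 1. *)
  have := scaled ((1 + s^-1) / 2); rewrite -/s.
  have -> : (1 + s^-1) / 2 * s = (s + 1) / 2.
    by rewrite mulrAC mulrDl mul1r mulVf ?gt_eqF.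
  by move=> /(_ ltac:(lra) ltac:(lra)); lra.
move=> t0 t1; apply: le1; first by rewrite mulr_ge0 ?powR_ge0 ?ltW.
rewrite powRM ?powR_ge0 ?(ltW t0)// SE.
(* A positive lower bound for the nonzero [a i]; the default 1 keeps m positive when all of them
   vanish. *)
pose m := \big[Num.min/1]_(i < n | 0 < a i) a i.
have m0 : 0 < m by apply/bigmin_gtP; split.
have := ha ((1 - theta) * m); rewrite mulr_gt0 ?subr_gt0// => /(_ isT).
apply: le_trans; rewrite mulr_sumr; apply: ler_sum => i _.
rewrite -powRM ?(ltW t0)// ge0_ler_powR ?nnegrE ?(ltW p0)//.
- by rewrite mulr_ge0 ?(ltW t0).
- by rewrite le_max lexx orbT.
have [ai|] := ltP 0 (a i); last first.
  by move=> ai; rewrite le_max [theta * _ <= 0]mulr_ge0_le0 ?orbT// ltW.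
rewrite le_max; apply/orP; left.
have : (1 - theta) * m <= (1 - theta) * a i.
  by rewrite ler_wpM2l ?subr_ge0 ?(ltW t1)//; exact: bigmin_le_cond.
rewrite [X in _ <= X]mulrBl mul1r; lra.
Qed.

(** Truncating the f_i and y_m by w = |y_m| /\ |sum f| makes them disjoint at the cost |w|, which is
    arbitrarily small for large m. Only cofinally many m need a large y_m. *)
Lemma pythagoras_tau_limit (R : realType) (p : R) (V : banachLatticeType R)
    n (f : 'I_n -> V) (eta : R) (y_ : nat -> V) :
  1 <= p -> lower_estimate V p -> disjoint_family f -> 0 <= eta ->
  (forall N, exists2 m, (N <= m)%N & eta <= `|y_ m|) ->
  (fun m => `|bmeet (babs (y_ m)) (babs (\sum_i f i))| : R^o) @ \oo --> (0 : R^o) ->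
  (forall m, norm0 p (\sum_i f i + y_ m) <= 1) ->
  \sum_i `|f i| `^ p + eta `^ p <= 1.
Proof.
move=> p1 hV fd eta0 y_eta yw y1; have p0 : 0 < p by exact: lt_le_trans p1.
pose a (i : 'I_n.+1) := oapp (fun j => `|f j|) eta (unlift ord0 i).
have -> : \sum_i `|f i| `^ p + eta `^ p = \sum_i a i `^ p.
  rewrite big_ord_recl /a unlift_none /= addrC; congr (_ + _).
  by apply: eq_bigr => i _; rewrite liftK.
apply: sum_powR_le1_of_sub => // [i|t t0]; first by rewrite /a; case: unlift => /=.
(* With y adjoined the family has n + 1 members, so [sum_powR_almost_disjoint] loses (n + 2) s =
   t. *)
pose s := t / n.+2%:R; have s0 : 0 < s by rewrite divr_gt0// ltr0n.
have /cvgrPdist_le/(_ s s0) [N _ hN] := yw.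
have [m Nm ym] := y_eta N.
have {}hN : `|bmeet (babs (y_ m)) (babs (\sum_i f i))| <= s.
  by have := hN m Nm; rewrite /= sub0r normrN normr_id.
set y := y_ m in hN ym; set x := \sum_i f i in hN.
set w := bmeet (babs y) (babs x) in hN.
have w0 : ble 0 w by rewrite bmeet_ge0 ?babs_ge0.
pose g (i : 'I_n.+1) := oapp f y (unlift ord0 i).
have gE : \sum_i g i = x + y.
  rewrite big_ord_recl /g unlift_none /= addrC; congr (_ + _).
  by apply: eq_bigr => i _; rewrite liftK.
have fx i : ble (babs (f i)) (babs x).
  rewrite /x (bigD1 i)//=; apply: bdisj_babsD; apply: bdisjC.
  by apply: bdisj_sum => j ji; exact: fd.
have le0 z z' : ble (babs z) z' -> ble w z' -> ble (babs (btrunc w z)) (z' - w).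
  move=> zz' wz'; apply: ble_tr (babs_btrunc _ _) _.
  by rewrite ble_join bsubr_ge0 wz' bleD ?ble_refl.
have fle i : ble (babs (btrunc w (f i))) (babs (f i)).
  apply: ble_tr (babs_btrunc _ _) _.
  by rewrite ble_join babs_ge0 bleBDl.
(* The truncations lie below |y| - w and |x| - w, the disjoint remainders of the meet w. *)
have yf i : bdisjoint (btrunc w y) (btrunc w (f i)).
  apply: (bdisj_of_le (a := babs y - w) (b := babs x - w)).
  - by apply: le0; rewrite ?ble_refl ?ble_meetl.
  - by apply: le0; rewrite ?ble_meetr.
  - exact: bmeet_subl_disjoint.
have vd : disjoint_family (fun i => btrunc w (g i)).
  move=> i j; rewrite /g.
  case: (unliftP ord0 i) => [i'|] ->; case: (unliftP ord0 j) => [j'|] -> /=.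
  - rewrite (inj_eq lift_inj) => ij; apply: bdisj_le (fle i') _.
    by apply: bdisjC; apply: bdisj_le (fle j') _; apply: fd; rewrite eq_sym.
  - by move=> _; exact: bdisjC.
  - by move=> _; exact: yf.
  - by [].
have gv i : `|g i - btrunc w (g i)| <= s.
  by apply: le_trans hN; apply: norm_babs_le; exact: babs_sub_btrunc.
have := sum_powR_almost_disjoint p1 hV vd gv.
have -> : n.+2%:R * s = t by rewrite mulrC divfK// pnatr_eq0.
rewrite gE => h; apply: (@le_trans _ _ (norm0 p (x + y) `^ p)); last first.
  rewrite -[X in _ <= X](powR_one p) ge0_ler_powR ?nnegrE ?(ltW p0)//; last exact: y1.
  exact: norm0_ge0 hV _.
apply: le_trans h; apply: ler_sum => i _.
have max_ge0 (r : R) : 0 <= Num.max r 0 by rewrite le_max lexx orbT.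
rewrite ge0_ler_powR ?nnegrE ?(ltW p0) ?max_ge0//.
rewrite ge_max !le_max lexx orbT andbT lerD2r; apply/orP; left.
by rewrite /a /g; case: (unliftP ord0 i) => [i'|] _ /=.
Qed.

(** * The uniform Kadec-Klee property *)

Theorem theorem4 (R : realType) (p : R) (hp : 1 <= p)
    (X : banachLatticeType R) (hX : lower_estimate X p) :
  tau_UKK (fun x : X => norm0 p x).
Proof.
move=> eps eps0; have p0 : 0 < p by exact: lt_le_trans hp.
have [C C0 hC] := norm0_le_norm hp hX.
(* Two points within eta of x are less than 2 C eta <= eps apart in [norm0]; the cap 1 keeps 1 -
   eta^p nonnegative. *)
pose eta := Num.min 1 (eps / (2 * C)).
have eta0 : 0 < eta by rewrite lt_min ltr01 divr_gt0// mulr_gt0.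
have eta1 : eta <= 1 by rewrite ge_min lexx.
have etaC : 2 * (C * eta) <= eps.
  by rewrite mulrA mulrC -ler_pdivlMr ?mulr_gt0// ge_min lexx orbT.
have etap0 : 0 < eta `^ p by exact: powR_gt0.
have etap1 : eta `^ p <= 1.
  by rewrite -[leRHS](powR_one p) ge0_ler_powR ?nnegrE ?(ltW p0) ?(ltW eta0).
(* Chosen so that 1 - delta is the p-th root of 1 - eta^p. *)
exists (1 - (1 - eta `^ p) `^ p^-1).
  rewrite subr_gt0 -[ltRHS](powR_one p^-1) gt0_ltr_powR ?invr_gt0 ?nnegrE//; lra.
move=> x_ x x1 sep xx; rewrite opprB addrC subrK.
apply: ge_sup => [|_ [n [f [fd xf ->]]]]; first by case: (norm0_has_sup x hX).
have sepn i j : i != j -> eps <= norm0 p (x_ i - x_ j : X).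
  move=> ij; apply: le_trans sep _; apply: ge_inf; last by exists (i, j).
  by exists 0 => _ [ij' _ <-]; exact: norm0_ge0.
(* By separation, [x_ N] and [x_ N.+1] cannot both be within eta of x. *)
have far N : exists2 m, (N <= m)%N & eta <= `|(x_ m : X) - x|.
  have [h|h] := leP eta `|(x_ N : X) - x|; first by exists N.
  exists N.+1 => //; rewrite leNgt; apply/negP => h'.
  have := sepn _ _ (negbT (ltn_eqF (ltnSn N))).
  have := hC (x_ N - x_ N.+1 : X).
  have : C * `|(x_ N : X) - x_ N.+1| < C * (2 * eta).
    rewrite ltr_pM2l//.
    have := ler_distD (x : X) (x_ N : X) (x_ N.+1 : X).
    rewrite [`|(x : X) - _|]distrC; lra.
  lra.
have := @pythagoras_tau_limit R p X n f eta (fun m => (x_ m : X) - x) hp hX fd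
  (ltW eta0) far.
rewrite -xf => /(_ ((tau_cvgP _ _).1 xx _ (babs_ge0 _))) h.
have {h} : \sum_i `|f i| `^ p + eta `^ p <= 1.
  by apply: h => m; rewrite addrC subrK.
have : 0 <= \sum_i `|f i| `^ p.
  by rewrite sumr_ge0// => i _; exact: powR_ge0.
move=> s0 s1; rewrite ge0_ler_powR ?nnegrE ?invr_ge0 ?(ltW p0)//; lra.
Qed.
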